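(* Let $m\ge1$ and $1\le i\le m$ be integers, let \[ G_{m,i}(z,q)=\Bigl(\prod_{b=1}^{i-1}\frac{1}{1-q^b}\Bigr)\prod_{a=1}^\infty\prod_{d=0}^{m-1}\frac{1}{1-z^aq^{i+(a-1)m+d}}, \] and $F_N(z)=[q^N]G_{m,i}(z,q)$ (so $F_N=0$ for $N<0$). If $m>i+1$ and $j>n/(i+1)$, then $[z^j]F_n(z)=[z^{j-1}]F_{n-i}(z)$. Equivalently, $\Lambda_{m,i}(n,j)=\Lambda_{m,i}(n-i,j-1)$ under these conditions.
   Context: $G_{m,i}$ equals the generating function $\sum_{n,k}\Lambda_{m,i}(n,k)z^kq^n$, where $\Lambda_{m,i}(n,k)$ is the number of partitions $\lambda=(\lambda_1\ge\lambda_2\ge\cdots)$ of $n$ such that $\sum_{j\equiv i \pmod m}\lambda_j=k$. *)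

(* Defs.v *)
From HB Require Import structures.
From mathcomp Require Import all_boot all_order all_algebra.
From mathcomp Require Import boolp classical_sets.

Set Implicit Arguments.
Unset Strict Implicit.
Unset Printing Implicit Defensive.

Import Order.TTheory GRing.Theory Num.Theory.
Local Open Scope ring_scope.

(* The classical axioms of boolp serve only to give power series decidable
   equality, inverses and limits.
   Formal power series in q; [coefq f n] is the coefficient [q^n] f. *)
Record fps (R : comNzRingType) : Type := Fps { coefq : nat -> R }.

HB.instance Definition _ (R : comNzRingType) := gen_eqMixin (fps R).
HB.instance Definition _ (R : comNzRingType) := gen_choiceMixin (fps R).

Section FormalPowerSeries.
Variable R : comNzRingType.
Implicit Types (f g h : fps R) (c : R) (e n : nat).

Lemma fpsP f g : coefq f =1 coefq g -> f = g.
Proof. by case: f g => [f] [g] /= /funext ->. Qed.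

Definition fps_zero : fps R := Fps (fun _ => 0).
Definition fps_opp f : fps R := Fps (fun n => - coefq f n).
Definition fps_add f g : fps R := Fps (fun n => coefq f n + coefq g n).

Lemma fps_addA : associative fps_add.
Proof. by move=> f g h; apply: fpsP => n /=; rewrite addrA. Qed.
Lemma fps_addC : commutative fps_add.
Proof. by move=> f g; apply: fpsP => n /=; rewrite addrC. Qed.
Lemma fps_add0 : left_id fps_zero fps_add.
Proof. by move=> f; apply: fpsP => n /=; rewrite add0r. Qed.
Lemma fps_addN : left_inverse fps_zero fps_opp fps_add.
Proof. by move=> f; apply: fpsP => n /=; rewrite addNr. Qed.

HB.instance Definition _ := GRing.isZmodule.Build (fps R)
  fps_addA fps_addC fps_add0 fps_addN.

(* [fps_monom c e] is the monomial c q^e. *)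
Definition fps_monom c e : fps R := Fps (fun n => if n == e then c else 0).

Definition fps_mul f g : fps R :=
  Fps (fun n => \sum_(k < n.+1) coefq f k * coefq g (n - k)).

Lemma fps_mul_poly f g N n : (n <= N)%N ->
  coefq (fps_mul f g) n =
    ((\poly_(k < N.+1) coefq f k) * (\poly_(k < N.+1) coefq g k))`_n.
Proof.
move=> le_nN; rewrite coefM /=; apply: eq_bigr => k _; rewrite !coef_poly.
have le_kn : (k <= n)%N by rewrite -ltnS.
by rewrite !ltnS (leq_trans le_kn le_nN) (leq_trans (leq_subr _ _) le_nN).
Qed.

Lemma fps_mulC : commutative fps_mul.
Proof. by move=> f g; apply: fpsP => n; rewrite !(fps_mul_poly _ _ (leqnn n)) mulrC. Qed.

Lemma fps_mulA : associative fps_mul.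
Proof.
move=> f g h; apply: fpsP => n.
pose T (u : fps R) := \poly_(k < n.+1) coefq u k.
have E u v : coefq (fps_mul u v) n = (T u * T v)`_n
  by exact: fps_mul_poly (leqnn n).
have trunc u v w : (T (fps_mul u v) * T w)`_n = (T u * T v * T w)`_n.
  rewrite !coefM; apply: eq_bigr => k _; congr (_ * _).
  by rewrite coef_poly ltn_ord (@fps_mul_poly _ _ n) // -ltnS.
by rewrite !E trunc mulrC trunc mulrC mulrA.
Qed.

Lemma fps_mul1 : left_id (fps_monom 1 0) fps_mul.
Proof.
move=> f; apply: fpsP => n /=; rewrite big_ord_recl /= mul1r subn0.
by rewrite big1 ?addr0 // => k _; rewrite mul0r.
Qed.

Lemma fps_mulDl : left_distributive fps_mul fps_add.
Proof.
move=> f g h; apply: fpsP => n /=; rewrite -big_split /=.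
by apply: eq_bigr => k _; rewrite mulrDl.
Qed.

Lemma fps_1neq0 : fps_monom 1 0 != fps_zero.
Proof.
apply/eqP => /(congr1 (fun f => coefq f 0)) /= /eqP.
by rewrite oner_eq0.
Qed.

HB.instance Definition _ := GRing.Zmodule_isComNzRing.Build (fps R)
  fps_mulA fps_mulC fps_mul1 fps_mulDl fps_1neq0.

Definition fps_unit : {pred fps R} := [pred f | `[< exists g, g * f = 1 >]].
Definition fps_inv f : fps R := xget f [set g | g * f = 1]%classic.

Lemma fps_mulV : {in fps_unit, left_inverse 1 fps_inv *%R}.
Proof. by move=> f /asboolP ex_g; apply: (xgetPex f ex_g). Qed.
Lemma fps_unitPl f g : g * f = 1 -> fps_unit f.
Proof. by move=> fg1; apply/asboolP; exists g. Qed.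
Lemma fps_inv_out : {in [predC fps_unit], fps_inv =1 id}.
Proof.
move=> f /asboolPn nunit_f; rewrite /fps_inv.
by case: xgetP => // g _ fg1; case: nunit_f; exists g.
Qed.

HB.instance Definition _ := GRing.ComNzRing_hasMulInverse.Build (fps R)
  fps_mulV fps_unitPl fps_inv_out.

Lemma coefq0 n : coefq (0 : fps R) n = 0. Proof. by []. Qed.
Lemma coefq1 n : coefq (1 : fps R) n = (n == 0)%:R.
Proof. by rewrite /=; case: eqP. Qed.
Lemma coefqD f g n : coefq (f + g) n = coefq f n + coefq g n. Proof. by []. Qed.
Lemma coefqN f n : coefq (- f) n = - coefq f n. Proof. by []. Qed.
Lemma coefqM f g n :
  coefq (f * g) n = \sum_(k < n.+1) coefq f k * coefq g (n - k).
Proof. by []. Qed.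

Lemma coefq_monomM c e f n :
  coefq (fps_monom c e * f) n = if (e <= n)%N then c * coefq f (n - e) else 0.
Proof.
rewrite coefqM; case: leqP => [le_en | lt_ne].
  rewrite (bigD1 (Ordinal (le_en : e < n.+1)%N)) //= eqxx big1 ?addr0 // => k.
  by rewrite -val_eqE /= => /negPf ->; rewrite mul0r.
rewrite big1 // => k _ /=; case: eqP => [Ek | _]; last by rewrite mul0r.
by have := ltn_ord k; rewrite Ek ltnS leqNgt lt_ne.
Qed.

Definition fps_geom c e : fps R :=
  Fps (fun n => if (e %| n)%N then c ^+ (n %/ e) else 0).

Lemma fps_geomP c e : (0 < e)%N -> fps_geom c e * (1 - fps_monom c e) = 1.
Proof.
move=> e_gt0; rewrite mulrC mulrBl mul1r; apply: fpsP => n.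
rewrite coefqD coefqN coefq_monomM coefq1 /=.
case: (posnP n) => [-> | n_gt0].
  by rewrite dvdn0 div0n expr0 leqn0 eqn0Ngt e_gt0 subr0.
case: leqP => [le_en | lt_ne]; last first.
  by rewrite gtnNdvd // subr0.
rewrite dvdn_subl //; case: ifP => [dv_en | _]; last by rewrite mulr0 subr0.
have [[|q] Dn] := dvdnP dv_en; first by rewrite Dn in n_gt0.
by rewrite Dn mulnK // mulSn addKn mulnK // -exprS subrr.
Qed.

Lemma fps_unit_1Bmonom c e : (0 < e)%N -> 1 - fps_monom c e \is a GRing.unit.
Proof. by move=> e_gt0; apply/unitrPr; exists (fps_geom c e); rewrite mulrC fps_geomP. Qed.

Lemma coefq_inv_1Bmonom c e n : (0 < e)%N ->
  coefq (1 - fps_monom c e)^-1 n = if (e %| n)%N then c ^+ (n %/ e) else 0.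
Proof.
move=> e_gt0; have U := fps_unit_1Bmonom c e_gt0.
suff -> : (1 - fps_monom c e)^-1 = fps_geom c e by [].
by apply: (mulIr U); rewrite mulVr // fps_geomP.
Qed.

(* Convergence in the q-adic topology: each coefficient is eventually constant. *)
Definition fps_cvg (u : nat -> fps R) (l : fps R) : Prop :=
  forall n, exists K, forall k, (K <= k)%N -> coefq (u k) n = coefq l n.

Definition fps_lim (u : nat -> fps R) : fps R :=
  xget 0 [set l | fps_cvg u l]%classic.

Lemma fps_cvg_unique u l l' : fps_cvg u l -> fps_cvg u l' -> l = l'.
Proof.
move=> ul ul'; apply: fpsP => n.
have [K HK] := ul n; have [K' HK'] := ul' n.
by rewrite -(HK (maxn K K')) ?leq_maxl // HK' ?leq_maxr.
Qed.

Lemma fps_cvg_lim u l : fps_cvg u l -> fps_lim u = l.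
Proof.
move=> ul; apply: xget_unique => // l' ul'.
exact: fps_cvg_unique ul' ul.
Qed.

Definition fps_one_mod e f : Prop := forall n, (n < e)%N -> coefq f n = (n == 0)%:R.

Lemma coefqM_one_mod e f g n : fps_one_mod e g -> (n < e)%N ->
  coefq (f * g) n = coefq f n.
Proof.
move=> g1 lt_ne; rewrite coefqM big_ord_recr /= subnn g1 ?(leq_ltn_trans _ lt_ne) //.
rewrite mulr1 big1 ?add0r // => k _.
rewrite g1 ?(leq_ltn_trans (leq_subr _ _) lt_ne) //.
by rewrite subn_eq0 leqNgt ltn_ord mulr0.
Qed.

Lemma fps_one_mod_prod e (I : Type) (r : seq I) (P : pred I) (f : I -> fps R) :
  (forall x, P x -> fps_one_mod e (f x)) ->
  fps_one_mod e (\prod_(x <- r | P x) f x).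
Proof.
move=> f1; elim/big_ind: _ => // [|f' g' f'1 g'1] n lt_ne; first by rewrite coefq1.
by rewrite (coefqM_one_mod _ g'1 lt_ne) f'1.
Qed.

Lemma fps_cvg_prod (f : nat -> fps R) :
  (forall a, (0 < a)%N -> fps_one_mod a (f a)) ->
  fps_cvg (fun A => \prod_(1 <= a < A.+1) f a)
    (fps_lim (fun A => \prod_(1 <= a < A.+1) f a)).
Proof.
move=> f1; set u := fun A => _.
pose l : fps R := Fps (fun n => coefq (u n) n).
suff ul : fps_cvg u l by rewrite (fps_cvg_lim ul).
move=> n; exists n; elim=> [|k IHk]; first by rewrite leqn0 => /eqP ->.
rewrite leq_eqVlt => /orP[/eqP -> // | lt_nk]; rewrite -(IHk lt_nk).
rewrite /u [in LHS]big_nat_recr //.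
exact: coefqM_one_mod (f1 k.+1 _) _.
Qed.

End FormalPowerSeries.

(* The ambient ring is Z[z][[q]], with z = 'X : {poly int}; it contains G and
   makes each [q^N] G a polynomial in z. *)
Definition Gfactor (m i a : nat) : fps {poly int} :=
  \prod_(0 <= d < m) (1 - fps_monom 'X^a (i + (a - 1) * m + d))^-1.

Definition G (m i : nat) : fps {poly int} :=
  (\prod_(1 <= b < i) (1 - fps_monom 1 b)^-1)
  * fps_lim (fun A => \prod_(1 <= a < A.+1) Gfactor m i a).

(* The infinite product converges, so [fps_lim] is not its default value. *)
Lemma Gfactor_cvg (m i : nat) : (0 < m)%N -> (0 < i)%N ->
  fps_cvg (fun A => \prod_(1 <= a < A.+1) Gfactor m i a)
    (fps_lim (fun A => \prod_(1 <= a < A.+1) Gfactor m i a)).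
Proof.
move=> m_gt0 i_gt0; apply: fps_cvg_prod => a a_gt0.
apply: fps_one_mod_prod => d _ n lt_na.
set e := (i + _ + d)%N.
have le_ae : (a <= e)%N.
  rewrite /e -[X in (X <= _)%N](subnKC a_gt0) -addnA leq_add //.
  by rewrite (leq_trans (leq_pmulr _ m_gt0)) ?leq_addr.
have lt_ne := leq_trans lt_na le_ae.
rewrite coefq_inv_1Bmonom ?(leq_ltn_trans _ lt_ne) //.
case: (posnP n) => [-> | n_gt0]; first by rewrite dvdn0 div0n.
by rewrite gtnNdvd.
Qed.

(* F_N = [q^N] G, with F_N = 0 for N < 0. *)
Definition F (m i : nat) (N : int) : {poly int} :=
  if N is Posz n then coefq (G m i) n else 0.

(* [z^j] p, which is 0 for j < 0. *)
Definition coefz (p : {poly int}) (j : int) : int :=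
  if j is Posz k then p`_k else 0.

(* A partition of n is encoded as its sequence of parts
   lambda_1 >= lambda_2 >= ... >= lambda_n >= 0 padded with zeros to length n;
   the part lambda_(j+1) is [l j], since 'I_n is numbered from 0. *)
Definition is_partition (n : nat) (l : {ffun 'I_n -> 'I_n.+1}) : bool :=
  [forall j : 'I_n, forall k : 'I_n, (j <= k)%N ==> (l k <= l j)%N]
  && (\sum_(j < n) (l j : nat) == n)%N.

Definition mod_part_sum (m i n : nat) (l : {ffun 'I_n -> 'I_n.+1}) : nat :=
  (\sum_(j < n | j.+1 == i %[mod m]) (l j : nat))%N.

(* Lambda_{m,i}(n,k), which is 0 for n < 0 or k < 0. *)
Definition Lambda (m i : nat) (n k : int) : nat :=
  if n is Posz n' then
    #|[set l : {ffun 'I_n' -> 'I_n'.+1}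
        | is_partition l & (mod_part_sum m i l)%:Z == k]|
  else 0%N.

(* Main.v *)
Require Import Defs.
From mathcomp Require Import all_boot all_order all_algebra.
From mathcomp Require Import zify.
Import Order.TTheory GRing.Theory Num.Theory.
Local Open Scope ring_scope.

(** A monomial z^k q^n of (1 - z q^i) G is a product of monomials q^b and
    z^a q^(i+(a-1)m+d) with (a,d) <> (1,0); since m >= i + 2, the exponent of q
    in each of them is at least i + 1 times that of z, so (i+1) k <= n.
    On partitions, multiplication by z q^i adds 1 to each of the first i parts.
    This is a bijection onto the partitions with lambda_i > lambda_(i+1), and
    when lambda_i = lambda_(i+1) each part lambda_j with j = i mod m is at most
    the average of a window of i + 1 consecutive parts, these windows being
    disjoint because m >= i + 2; hence again (i+1) k <= n. *)

(** * Slopes of the monomials z^k q^n of a power series *)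

Definition slope_ge (c : nat) (f : fps {poly int}) : Prop :=
  forall n k, (n < c * k)%N -> (coefq f n)`_k = 0.

Lemma slope_ge1 (c : nat) : slope_ge c 1.
Proof.
move=> n k ltn; rewrite coefq1; case: n ltn => [|n] ltn /=; last by rewrite coef0.
by rewrite coef1; case: k ltn => //; rewrite muln0.
Qed.

Lemma slope_geM (c : nat) (f g : fps {poly int}) :
  slope_ge c f -> slope_ge c g -> slope_ge c (f * g).
Proof.
move=> sf sg n k ltn; rewrite coefqM coef_sum big1 // => u _.
rewrite coefM big1 // => v _.
have [lt_u | le_u] := ltnP u (c * v); first by rewrite sf ?mul0r.
have le_un : (u <= n)%N by rewrite -ltnS.
have le_vk : (v <= k)%N by rewrite -ltnS.
rewrite sg ?mulr0 // mulnBr.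
by move: (leq_mul (leqnn c) le_vk); lia.
Qed.

Lemma slope_ge_prod (c : nat) (I : Type) (r : seq I) (P : pred I)
    (f : I -> fps {poly int}) :
  (forall x, P x -> slope_ge c (f x)) -> slope_ge c (\prod_(x <- r | P x) f x).
Proof. by apply: big_ind; [exact: slope_ge1 | exact: slope_geM]. Qed.

(** The inverse is the geometric series in z^a q^e. The case a = 0 serves the z-free factors of
    [G]. *)
Lemma slope_ge_inv (c a e : nat) : (0 < e)%N -> (c * a <= e)%N ->
  slope_ge c (1 - fps_monom 'X^a e)^-1.
Proof.
move=> e_gt0 le_cae n k ltn; rewrite coefq_inv_1Bmonom //.
case: ifP => [/dvdnP [q Dn] | _]; last by rewrite coef0.
rewrite Dn mulnK // -exprM coefXn; case: eqP => // Dk.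
by move: ltn; rewrite Dn Dk mulnA ltnNge mulnC leq_mul2l le_cae orbT.
Qed.

(** The exponent of q is at least i + (a-1)(i+2) = (i+1)a + (a-2), hence the condition a >= 2. *)
Lemma Gfactor_slope_ge (m i a : nat) : (0 < i)%N -> (i + 1 < m)%N ->
  (1 < a)%N -> slope_ge (i + 1) (Gfactor m i a).
Proof.
move=> i_gt0 lt_im a_gt1; apply: slope_ge_prod => d _.
apply: slope_ge_inv; first by rewrite -addnA addn_gt0 i_gt0.
case: a a_gt1 => [|[|a]] // _; rewrite subn1 /=.
have : (a.+1 * (i + 2) <= a.+1 * m)%N by rewrite leq_mul2l; apply/orP; right; lia.
by lia.
Qed.

(** The factor d = 0 is 1/(1 - z q^i), the only one of slope below i + 1. It cancels, and the others
    have exponent i + d >= i + 1. *)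
Lemma Gfactor1_slope_ge (m i : nat) : (0 < i)%N -> (i + 1 < m)%N ->
  slope_ge (i + 1) (Gfactor m i 1 * (1 - fps_monom 'X i)).
Proof.
move=> i_gt0 lt_im; rewrite /Gfactor big_ltn ?(leq_ltn_trans _ lt_im) //.
rewrite subnn mul0n !addn0 expr1 mulrAC mulVr ?fps_unit_1Bmonom // mul1r.
rewrite big_nat; apply: slope_ge_prod => d /andP [d_gt0 _].
by rewrite -['X]expr1; apply: slope_ge_inv; lia.
Qed.

Lemma coefq_M1Bmonom (R : comNzRingType) (c : R) (e n : nat) (f : fps R) :
  coefq (f * (1 - fps_monom c e)) n =
  coefq f n - (if (e <= n)%N then c * coefq f (n - e) else 0).
Proof. by rewrite mulrBr mulr1 coefqD coefqN [f * _]mulrC coefq_monomM. Qed.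

Lemma G_slope_ge (m i : nat) : (0 < i)%N -> (i + 1 < m)%N ->
  slope_ge (i + 1) (G m i * (1 - fps_monom 'X i)).
Proof.
move=> i_gt0 lt_im; rewrite /G -mulrA; apply: slope_geM.
  rewrite big_nat; apply: slope_ge_prod => b /andP [b_gt0 _].
  by rewrite -(expr0 'X); apply: slope_ge_inv; rewrite ?muln0.
move=> n k ltn.
have m_gt0 : (0 < m)%N by lia.
have cvgG := @Gfactor_cvg m i m_gt0 i_gt0.
have [K1 HK1] := cvgG n; have [K2 HK2] := cvgG (n - i)%N.
(* Only the coefficients n and n - i of the limit matter, so a partial product can replace it. The
   successor ensures that this product contains the factor a = 1. *)
pose A := (K1 + K2).+1.
rewrite coefq_M1Bmonom -(HK1 A) -?(HK2 A) -?coefq_M1Bmonom; try lia.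
rewrite big_ltn // mulrAC; apply: slope_geM ltn; first exact: Gfactor1_slope_ge.
rewrite big_nat; apply: slope_ge_prod => a /andP [a_gt1 _].
exact: Gfactor_slope_ge.
Qed.

Lemma coefz_G (m i n k : nat) : (0 < i)%N -> (i + 1 < m)%N ->
  (n < (i + 1) * k.+1)%N ->
  (coefq (G m i) n)`_k.+1 = if (i <= n)%N then (coefq (G m i) (n - i))`_k else 0.
Proof.
move=> i_gt0 lt_im ltn; have := @G_slope_ge m i i_gt0 lt_im n k.+1 ltn.
rewrite coefq_M1Bmonom coefB => /eqP; rewrite subr_eq0 => /eqP ->.
by case: ifP => _; rewrite ?coef0 // coefXM.
Qed.

(** * Partitions as finitely supported sequences *)

(** Extension by zero puts partitions padded to the different lengths n and n + i on a common index
    range. *)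
Definition part_at {n : nat} (l : {ffun 'I_n -> 'I_n.+1}) (t : nat) : nat :=
  oapp (fun j => l j : nat) 0%N (insub t).

(** [inord] turns values above n into 0, and entries from index n on are dropped; [part_at_of_parts]
    shows that nothing is lost for a nonincreasing, finitely supported sequence of sum n. *)
Definition of_parts (n : nat) (h : nat -> nat) : {ffun 'I_n -> 'I_n.+1} :=
  [ffun t : 'I_n => inord (h t)].

Definition nonincr (h : nat -> nat) : Prop := forall s t, (s <= t)%N -> (h t <= h s)%N.

Lemma part_at_ord (n : nat) (l : {ffun 'I_n -> 'I_n.+1}) (t : 'I_n) :
  part_at l t = l t.
Proof. by rewrite /part_at valK. Qed.

Lemma part_at_out (n : nat) (l : {ffun 'I_n -> 'I_n.+1}) (t : nat) :
  (n <= t)%N -> part_at l t = 0%N.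
Proof. by move=> le_nt; rewrite /part_at insubF // ltnNge le_nt. Qed.

Lemma part_at_inj (n : nat) (l l' : {ffun 'I_n -> 'I_n.+1}) :
  part_at l =1 part_at l' -> l = l'.
Proof. by move=> E; apply/ffunP => t; apply: val_inj; rewrite /= -!part_at_ord E. Qed.

Lemma sum_widen0 (n M : nat) (P : pred nat) (h : nat -> nat) : (n <= M)%N ->
  (forall t, (n <= t)%N -> h t = 0%N) ->
  (\sum_(0 <= t < M | P t) h t = \sum_(0 <= t < n | P t) h t)%N.
Proof.
move=> le_nM h0; rewrite (@big_cat_nat _ _ _ n) //= [X in (_ + X)%N]big_nat_cond.
by rewrite [X in (_ + X)%N]big1 ?addn0 // => t /andP [/andP [/h0]].
Qed.

Lemma mod_part_sumE (m i n M : nat) (l : {ffun 'I_n -> 'I_n.+1}) : (n <= M)%N ->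
  mod_part_sum m i l = (\sum_(0 <= t < M | t.+1 == i %[mod m]) part_at l t)%N.
Proof.
move=> le_nM; rewrite (@sum_widen0 n) // => [|t]; last exact: part_at_out.
by rewrite big_mkord; apply: eq_bigr => t _; rewrite part_at_ord.
Qed.

Lemma is_partitionP (n M : nat) (l : {ffun 'I_n -> 'I_n.+1}) : (n <= M)%N ->
  reflect (nonincr (part_at l) /\ (\sum_(0 <= t < M) part_at l t = n)%N)
    (is_partition l).
Proof.
move=> le_nM; rewrite (@sum_widen0 n) // => [|t]; last exact: part_at_out.
rewrite big_mkord (eq_bigr (fun t : 'I_n => l t : nat)) => [|t _]; last exact: part_at_ord.
apply: (iffP andP) => [[/forallP mono /eqP sum_l] | [mono sum_l]]; split=> //.
- move=> s t le_st; have [lt_tn | le_nt] := ltnP t n; last by rewrite part_at_out.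
  have lt_sn := leq_ltn_trans le_st lt_tn.
  have /forallP /(_ (Ordinal lt_tn)) /implyP := mono (Ordinal lt_sn).
  by rewrite -!part_at_ord; apply.
- apply/forallP => s; apply/forallP => t; apply/implyP.
  by rewrite -!part_at_ord; apply: mono.
- exact/eqP.
Qed.

Lemma nonincr_sum_ge (h : nat -> nat) (b k : nat) : nonincr h ->
  (k.+1 * h (b + k) <= \sum_(b <= t < b + k.+1) h t)%N.
Proof.
move=> mono; rewrite -[X in (X * _ <= _)%N](addKn b k.+1) -sum_nat_const_nat.
rewrite big_nat [X in (_ <= X)%N]big_nat; apply: leq_sum => t /andP [_ lt_t].
by apply: mono; rewrite -ltnS -addnS.
Qed.

(** The first t + 1 terms are all at least h t, so (t + 1) h t <= n; this bounds both the values and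
    the support. *)
Lemma nonincr_sum_le (h : nat -> nat) (n M : nat) : nonincr h ->
  (forall t, (M <= t)%N -> h t = 0%N) -> (\sum_(0 <= t < M) h t = n)%N ->
  (forall t, h t <= n)%N /\ (forall t, (n <= t)%N -> h t = 0%N).
Proof.
move=> mono h0 sum_h.
have bound t : (t.+1 * h t <= n)%N.
  have [lt_tM | /h0 ->] := ltnP t M; last by rewrite muln0.
  have := @nonincr_sum_ge h 0 t mono; rewrite !add0n => /leq_trans -> //.
  by rewrite -sum_h [X in (_ <= X)%N](@big_cat_nat _ _ _ t.+1) //= leq_addr.
split=> t; first by apply: leq_trans (bound t); rewrite leq_pmull.
move=> le_nt; apply/eqP; rewrite -leqn0 leqNgt; apply/negP => ht_gt0.
by have := leq_trans (leq_pmulr t.+1 ht_gt0) (bound t); rewrite ltnNge le_nt.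
Qed.

Lemma part_at_of_parts (h : nat -> nat) (n M : nat) : nonincr h ->
  (forall t, (M <= t)%N -> h t = 0%N) -> (\sum_(0 <= t < M) h t = n)%N ->
  part_at (of_parts n h) =1 h.
Proof.
move=> mono h0 sum_h t; have [h_le h_out] := nonincr_sum_le _ _ _ mono h0 sum_h.
have [lt_tn | le_nt] := ltnP t n; last by rewrite part_at_out ?h_out.
by rewrite -[t in LHS]/(val (Ordinal lt_tn)) part_at_ord ffunE inordK ?ltnS.
Qed.

(** * Parts of index i modulo m, and window averages *)

Lemma eq_succ_mod (m i t : nat) : (i < m)%N -> (t < m - 1)%N ->
  (t.+1 == i %[mod m]) = (t.+1 == i).
Proof. by move=> lt_im lt_tm; rewrite !modn_small //; lia. Qed.

(** Among the first i parts only lambda_i has index congruent to i, so adding 1 to each of them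
    raises the residue sum by 1. *)
Lemma sum_mod_lt (m i M : nat) : (0 < i)%N -> (i + 1 < m)%N -> (i <= M)%N ->
  (\sum_(0 <= t < M | t.+1 == i %[mod m]) (t < i) = 1)%N.
Proof.
move=> i_gt0 lt_im le_iM.
rewrite (@sum_widen0 i _ (fun t => t.+1 == i %[mod m]) (fun t => (t < i)%N)) //; last first.
  by move=> t le_it; rewrite ltnNge le_it.
rewrite big_nat_cond (eq_bigl (fun t => (0 <= t < i)%N && (t == i.-1))); last first.
  by move=> t; case: (ltnP t i) => //= lt_ti; rewrite eq_succ_mod; lia.
by rewrite -big_nat_cond big_nat1_eq prednK // leqnn.
Qed.

Lemma sum_lt (i M : nat) : (i <= M)%N -> (\sum_(0 <= t < M) (t < i) = i)%N.
Proof.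
move=> le_iM; rewrite (@sum_widen0 i _ xpredT (fun t => (t < i)%N)) //; last first.
  by move=> t le_it; rewrite ltnNge le_it.
rewrite big_nat (eq_bigr (fun=> 1%N)) => [|t /andP [_ ->] //].
by rewrite -big_nat sum_nat_const_nat subn0 muln1.
Qed.

Lemma nonincr_window (h : nat -> nat) (b i m : nat) : nonincr h ->
  (i < m)%N -> (i.+1 * h (b + i) <= \sum_(b <= t < b + m) h t)%N.
Proof.
move=> mono lt_im; apply: leq_trans (nonincr_sum_ge _ b i mono) _.
by rewrite [X in (_ <= X)%N](@big_cat_nat _ _ _ (b + i.+1)) ?leq_addr //= ?leq_add2l.
Qed.

(* The cuts at a m - 1 separate the windows: the first is [0, i], the others
   are [a m - 1, a m - 1 + i]. *)
Lemma nonincr_mod_sum_le (h : nat -> nat) (m i a : nat) : nonincr h ->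
  (0 < i)%N -> (i + 1 < m)%N -> h i.-1 = h i ->
  ((i + 1) * \sum_(0 <= t < a.+1 * m - 1 | t.+1 == i %[mod m]) h t
    <= \sum_(0 <= t < a.+1 * m - 1) h t)%N.
Proof.
move=> mono i_gt0 lt_im Eh; elim: a => [|a IHa].
  rewrite mul1n big_nat_cond (eq_bigl (fun t => t == i.-1)) => [|t]; last first.
    case: (ltnP t (m - 1)) => lt_tm; last by lia.
    by rewrite eq_succ_mod //=; [apply/eqP/eqP; lia | lia].
  (* The equality [Eh] lets the first window end at index i instead of i - 1, which gives it i + 1
     terms. *)
  have -> : (\sum_(0 <= t < m - 1 | t == i.-1) h t = h i)%N.
    by rewrite big_nat1_eq ifT //; lia.
  rewrite addn1; have := @nonincr_window h 0 i (m - 1) mono.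
  by rewrite !add0n; apply; lia.
set b := (a.+1 * m - 1)%N in IHa *.
have -> : (a.+2 * m - 1 = b + m)%N by rewrite /b; lia.
rewrite !(@big_cat_nat _ _ _ b 0 (b + m)) ?leq_addr //= mulnDr leq_add //.
(* Since b + 1 is a multiple of m, the only index of the residue class in this period is b + i, the
   last of its window. *)
have -> : (\sum_(b <= t < b + m | t.+1 == i %[mod m]) h t = h (b + i))%N.
  rewrite big_nat_cond (eq_bigl (fun t => (b <= t < b + m)%N && (t == b + i)%N)).
    by rewrite -big_nat_cond big_nat1_eq ifT //; lia.
  move=> t; case: (boolP (b <= t < b + m)%N) => //= /andP [le_bt lt_t].
  have -> : t.+1 = (a.+1 * m + (t - b))%N by rewrite /b in le_bt lt_t *; lia.
  by rewrite modnMDl !modn_small; [apply/eqP/eqP; lia | lia | lia].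
by rewrite addn1 nonincr_window //; lia.
Qed.

(** Equality of lambda_i and lambda_(i+1) would let the window averages bound (i+1) times the
    residue sum by n. The length [M] has the form a window cut requires. *)
Lemma partition_strict (m i n : nat) (l : {ffun 'I_n -> 'I_n.+1}) :
  (0 < i)%N -> (i + 1 < m)%N -> is_partition l ->
  (n < (i + 1) * mod_part_sum m i l)%N -> (part_at l i < part_at l i.-1)%N.
Proof.
move=> i_gt0 lt_im part_l; set M := (n.+1 * m - 1)%N.
have le_nM : (n <= M)%N.
  by have : (n.+1 * 2 <= n.+1 * m)%N by [rewrite leq_mul2l; lia]; rewrite /M; lia.
have [mono sum_l] := is_partitionP _ _ _ le_nM part_l.
rewrite (mod_part_sumE _ _ _ _ _ le_nM) -[X in (X < _)%N]sum_l => lt_sum.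
rewrite ltn_neqAle mono ?leq_pred // andbT; apply/eqP => E.
by have := @nonincr_mod_sum_le _ m i n mono i_gt0 lt_im (esym E); rewrite leqNgt lt_sum.
Qed.

(** * Adding 1 to the first i parts, and the inverse operation *)

Definition shift_up (i : nat) (h : nat -> nat) (t : nat) : nat := (h t + (t < i))%N.
Definition shift_down (i : nat) (h : nat -> nat) (t : nat) : nat := (h t - (t < i))%N.

Lemma nonincr_shift_up (i : nat) (h : nat -> nat) :
  nonincr h -> nonincr (shift_up i h).
Proof. by move=> mono s t le_st; rewrite /shift_up; move: (mono _ _ le_st); lia. Qed.

Lemma nonincr_shift_down (i : nat) (h : nat -> nat) : (0 < i)%N ->
  nonincr h -> (h i < h i.-1)%N -> nonincr (shift_down i h).
Proof.
move=> i_gt0 mono lt_h s t le_st; rewrite /shift_down.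
have := mono _ _ le_st.
case: (ltnP s i) => lt_si; case: (ltnP t i) => lt_ti; try lia.
(* Here s < i <= t, and h t <= h i < h (i-1) <= h s leaves room for the subtraction. *)
by have := mono s i.-1; have := mono i t; lia.
Qed.

(** For t < i, h t >= h (i-1) > h i >= 0, so the subtraction is never truncated. *)
Lemma shift_downK (i : nat) (h : nat -> nat) : nonincr h -> (h i < h i.-1)%N ->
  shift_up i (shift_down i h) =1 h.
Proof.
move=> mono lt_h t; rewrite /shift_up /shift_down.
by case: (ltnP t i) => lt_ti; have := mono t i.-1; lia.
Qed.

Lemma shift_upK (i : nat) (h : nat -> nat) : shift_down i (shift_up i h) =1 h.
Proof. by move=> t; rewrite /shift_up /shift_down addnK. Qed.

Definition partitions_with (m i n k : nat) : {set {ffun 'I_n -> 'I_n.+1}} :=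
  [set l | is_partition l & mod_part_sum m i l == k].

Lemma LambdaE (m i n k : nat) : Lambda m i n k = #|partitions_with m i n k|.
Proof. by []. Qed.

Lemma of_parts_partition (m i n k M : nat) (h : nat -> nat) :
  (n <= M)%N -> nonincr h -> (forall t, (M <= t)%N -> h t = 0%N) ->
  (\sum_(0 <= t < M) h t = n)%N ->
  (\sum_(0 <= t < M | t.+1 == i %[mod m]) h t = k)%N ->
  of_parts n h \in partitions_with m i n k.
Proof.
move=> le_nM mono h0 sum_h mod_h; have E := part_at_of_parts _ _ _ mono h0 sum_h.
rewrite inE; apply/andP; split.
  apply/(is_partitionP _ _ _ le_nM); split; first by move=> s t; rewrite !E; apply: mono.
  by rewrite -[RHS]sum_h; apply: eq_bigr => t _.
by rewrite (mod_part_sumE _ _ _ _ _ le_nM) -mod_h; apply/eqP/eq_bigr => t _.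
Qed.

Section ShiftBijection.
Variables m i n k : nat.
Hypotheses (i_gt0 : (0 < i)%N) (lt_im : (i + 1 < m)%N).

Lemma shift_up_sums (l : {ffun 'I_n -> 'I_n.+1}) :
  l \in partitions_with m i n k -> let h := shift_up i (part_at l) in
  [/\ nonincr h, forall t, (n + i <= t)%N -> h t = 0%N,
      (\sum_(0 <= t < n + i) h t = n + i)%N
    & (\sum_(0 <= t < n + i | t.+1 == i %[mod m]) h t = k.+1)%N].
Proof.
have le_n := leq_addr i n; have le_i := leq_addl n i.
rewrite inE => /andP [/(is_partitionP _ _ _ le_n) [mono sum_l]].
rewrite (mod_part_sumE _ _ _ _ _ le_n) => /eqP mod_l h; split.
- exact: nonincr_shift_up.
- by move=> t le_t; rewrite /h /shift_up part_at_out; lia.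
- by rewrite big_split /= sum_l sum_lt.
- by rewrite big_split /= mod_l sum_mod_lt // addn1.
Qed.

Hypothesis lt_nk : (n + i < (i + 1) * k.+1)%N.

Lemma shift_down_sums (l : {ffun 'I_(n + i) -> 'I_(n + i).+1}) :
  l \in partitions_with m i (n + i) k.+1 -> let h := shift_down i (part_at l) in
  [/\ shift_up i h =1 part_at l, nonincr h, forall t, (n + i <= t)%N -> h t = 0%N,
      (\sum_(0 <= t < n + i) h t = n)%N
    & (\sum_(0 <= t < n + i | t.+1 == i %[mod m]) h t = k)%N].
Proof.
have le_i := leq_addl n i.
rewrite inE => /andP [part_l /eqP mod_l] h.
have [mono sum_l] := is_partitionP _ _ _ (leqnn _) part_l.
have lt_l : (part_at l i < part_at l i.-1)%N.
  by apply: (partition_strict m) part_l _; rewrite // mod_l.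
have hK := shift_downK _ _ mono lt_l.
split=> //; first exact: nonincr_shift_down.
- by move=> t le_t; rewrite /h /shift_down part_at_out.
(* To avoid truncated subtraction under the sum, the indicator of t < i is added back; its sum is i
   here and 1 over the residue class below. *)
- apply: (@addIn i); rewrite -[RHS]sum_l -[X in (_ + X)%N](@sum_lt i _ le_i).
  by rewrite -big_split; apply: eq_bigr => t _; apply: hK.
- apply: (@addIn 1%N); rewrite [RHS]addn1 -mod_l (mod_part_sumE _ _ _ _ _ (leqnn _)).
  rewrite -[X in (_ + X)%N](@sum_mod_lt m i _ i_gt0 lt_im le_i).
  by rewrite -big_split; apply: eq_bigr => t _; apply: hK.
Qed.

Lemma card_partitions_shift :
  #|partitions_with m i (n + i) k.+1| = #|partitions_with m i n k|.
Proof.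
have le_n := leq_addr i n.
pose up (l : {ffun 'I_n -> 'I_n.+1}) := of_parts (n + i) (shift_up i (part_at l)).
pose down (l : {ffun 'I_(n + i) -> 'I_(n + i).+1}) :=
  of_parts n (shift_down i (part_at l)).
have upP l : l \in partitions_with m i n k ->
    up l \in partitions_with m i (n + i) k.+1.
  by case/shift_up_sums => ? ? ? ?; apply: (@of_parts_partition _ _ _ _ (n + i)).
have downP l : l \in partitions_with m i (n + i) k.+1 ->
    down l \in partitions_with m i n k.
  by case/shift_down_sums => _ ? ? ? ?; apply: (@of_parts_partition _ _ _ _ (n + i)).
have upK : {in partitions_with m i n k, cancel up down}.
  move=> l Pl; apply: part_at_inj => t.
  have [_ mono h0 sum_h _] := shift_down_sums _ (upP l Pl).
  rewrite (part_at_of_parts _ _ _ mono h0 sum_h).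
  have [mono' h0' sum_h' _] := shift_up_sums _ Pl.
  by rewrite /shift_down (part_at_of_parts _ _ _ mono' h0' sum_h'); apply: shift_upK.
have downK : {in partitions_with m i (n + i) k.+1, cancel down up}.
  move=> l Pl; apply: part_at_inj => t.
  have [mono h0 sum_h _] := shift_up_sums _ (downP l Pl).
  rewrite (part_at_of_parts _ _ _ mono h0 sum_h).
  have [hK mono' h0' sum_h' _] := shift_down_sums _ Pl.
  by rewrite /shift_up (part_at_of_parts _ _ _ mono' h0' sum_h'); apply: hK.
(* Each inequality compares the image of an injective map with its target. *)
apply/eqP; rewrite eqn_leq -{1}(card_in_imset (can_in_inj downK)).
rewrite -[X in _ && (X <= _)%N](card_in_imset (can_in_inj upK)).
by apply/andP; split; apply: subset_leq_card; apply/subsetP => _ /imsetP [l Pl ->]; auto.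
Qed.

End ShiftBijection.

(** * Boundary cases and conclusion *)

(** All n slots have index below i < m, so none lies in the residue class and the residue sum is
    0. *)
Lemma partitions_with_small (m i n k : nat) : (i < m)%N -> (n < i)%N ->
  partitions_with m i n k.+1 = set0.
Proof.
move=> lt_im lt_ni; apply/setP => l; rewrite !inE /mod_part_sum big1 ?andbF // => t.
by rewrite eq_succ_mod //; have := ltn_ord t; lia.
Qed.

Theorem theorem8 (m i : nat) (n j : int)
    (hm : (1 <= m)%N) (hi1 : (1 <= i)%N) (him : (i <= m)%N)
    (hmi : (i + 1 < m)%N) (hj : n%:Q / (i + 1)%N%:Q < j%:Q) :
  coefz (F m i n) j = coefz (F m i (n - i%:Z)) (j - 1)
  /\ Lambda m i n j = Lambda m i (n - i%:Z) (j - 1).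
Proof.
have coefz0 k : coefz 0 k = 0 by case: k => k //=; rewrite coef0.
(* For n < 0 both sides vanish by convention. *)
case: n hj => [n | n] hj; last first.
  have -> : Negz n - i%:Z = Negz (n + i) by lia.
  by rewrite /= !coefz0.
have lt_n : (n%:Z < j * (i + 1)%N%:Z).
  move: hj; rewrite ltr_pdivrMr; last by rewrite ltr0z; lia.
  by rewrite -intrM ltr_int.
(* As n >= 0, the bound forces j >= 1. *)
case: j {hj} lt_n => [[|k] | k] lt_n; [by lia | | by nia].
have lt_nk : (n < (i + 1) * k.+1)%N by lia.
have -> : k.+1%:Z - 1 = k by lia.
have [le_in | lt_ni] := leqP i n.
  rewrite subzn // !LambdaE /= coefz_G // le_in; split=> //.
  by have := @card_partitions_shift m i (n - i) k hi1 hmi; rewrite subnK //; apply.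
(* For n < i the right-hand sides are 0 by convention, and the left-hand sides must be shown to
   vanish. *)
have -> : n%:Z - i%:Z = Negz (i - n).-1 by lia.
rewrite LambdaE partitions_with_small ?cards0 //; last by lia.
by rewrite /F /coefz coefz_G // leqNgt lt_ni coef0.
Qed.
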